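(* Let $n$ be an even positive integer. Let $\omega=\exp(\frac{\pi}{4}\mathbf i)$ and $\xi=\exp(\frac{\pi}{n}\mathbf i)$, where $\mathbf i^2=-1$. Then the irreducible complex matrix representations of $T_{8n}$ (up to equivalence, without repetition) are the following: (1) for $j\in\{0,2,4,6\}$, $\rho_{1j}: a\mapsto 1,\ b\mapsto\omega^j$; and for $j\in\{1,3,5,7\}$, $\rho_{1j}: a\mapsto -1,\ b\mapsto\omega^{j-1}$; (2) for $k\in\{2,4,\dots,n-2\}$, $\rho_{2k}: a\mapsto\begin{pmatrix}\xi^k&0\\0&\xi^{-k}\end{pmatrix},\ b\mapsto\begin{pmatrix}0&1\\1&0\end{pmatrix}$; and for $k\in\{1,3,\dots,n-1\}$, $\rho_{2k}: a\mapsto\begin{pmatrix}\xi^k&0\\0&\xi^{-k}\end{pmatrix},\ b\mapsto\begin{pmatrix}0&\mathbf i\\1&0\end{pmatrix}$; (3) for $h\in\{2,4,\dots,n-2\}$, $\rho_{3h}: a\mapsto\begin{pmatrix}\xi^h&0\\0&\xi^{-h}\end{pmatrix},\ b\mapsto\begin{pmatrix}0&-1\\1&0\end{pmatrix}$; and for $h\in\{1,3,\dots,n-1\}$, $\rho_{3h}: a\mapsto\begin{pmatrix}\xi^h&0\\0&\xi^{-h}\end{pmatrix},\ b\mapsto\begin{pmatrix}0&-\mathbf i\\1&0\end{pmatrix}$.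
   Context: $T_{8n}=\langle a,b\mid a^{2n}=b^8=e,\ a^n=b^4,\ b^{-1}ab=a^{-1}\rangle$ is a group of order $8n$. A matrix representation of a finite group $G$ is a homomorphism $G\to\mathrm{GL}(m,\mathbb C)$; two are equivalent if they are conjugate by an invertible matrix. *)

(* Defs.v *)
From mathcomp Require Import all_boot all_order all_algebra all_fingroup.
From mathcomp Require Import mxrepresentation.
From mathcomp Require Import complex.
From mathcomp Require Import reals sequences trigo.
Set Implicit Arguments.
Unset Strict Implicit.
Unset Printing Implicit Defensive.

Import Order.TTheory GRing.Theory Num.Theory.

Local Open Scope ring_scope.

(* G is a copy of T_{8n} with distinguished generators a and b. For a finitely
   presented group that is finite, as here (every word reduces to a ^+ i * b ^+ j
   with i < 2n, j < 8), [G \isog Grp p] says that G is isomorphic to it, but it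
   hides the generators. The remaining clauses name them: generators a, b of G
   satisfying the relations give a surjection <a, b | ...> -> G, which is an
   isomorphism since both groups have the same finite order. *)
Definition T8n_presented (gT : finGroupType) (n : nat) (G : {group gT})
    (a b : gT) : Prop :=
  [/\ (G \isog Grp (x : y : x ^+ (2 * n), y ^+ 8, x ^+ n = y ^+ 4,
                            y^-1 * x * y = x^-1))%g,
      (G :=: <<[set a; b]>>)%g
    & [/\ a ^+ (2 * n) = 1, b ^+ 8 = 1, a ^+ n = b ^+ 4
        & b^-1 * a * b = a^-1]%g].

Section Irreps.

Variable R : realType.
Local Notation C := R[i].

Definition cexp (z : C) : C :=
  let: (x +i* y)%C := z in ((expR x * cos y) +i* (expR x * sin y))%C.

Definition omega : C := cexp ((pi / 4%:R)%:C%C * 'i%C).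
Definition xi (n : nat) : C := cexp ((pi / n%:R)%:C%C * 'i%C).

Definition mx2 (x y z t : C) : 'M[C]_2 :=
  \matrix_(i < 2, j < 2) nth 0 (nth [::] [:: [:: x; y]; [:: z; t]] i) j.

(* Rho1 j, Rho2 k, Rho3 h stand for rho_{1j}, rho_{2k}, rho_{3h}. As n is even,
   {2, 4, .., n-2} and {1, 3, .., n-1} are the even and the odd numbers strictly
   between 0 and n. *)
Inductive T8n_label := Rho1 of nat | Rho2 of nat | Rho3 of nat.

Definition T8n_label_valid (n : nat) (l : T8n_label) : bool :=
  match l with
  | Rho1 j => (j < 8)%N
  | Rho2 k => (0 < k < n)%N
  | Rho3 h => (0 < h < n)%N
  end.

Definition T8n_degree (l : T8n_label) : nat :=
  match l with Rho1 _ => 1 | Rho2 _ => 2 | Rho3 _ => 2 end.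

Definition T8n_mx_a (n : nat) (l : T8n_label) : 'M[C]_(T8n_degree l) :=
  match l with
  | Rho1 j => if odd j then (- 1)%:M else 1%:M
  | Rho2 k => mx2 (xi n ^+ k) 0 0 (xi n ^- k)
  | Rho3 h => mx2 (xi n ^+ h) 0 0 (xi n ^- h)
  end.

Definition T8n_mx_b (l : T8n_label) : 'M[C]_(T8n_degree l) :=
  match l with
  | Rho1 j => if odd j then (omega ^+ (j - 1))%:M else (omega ^+ j)%:M
  | Rho2 k => if odd k then mx2 0 'i%C 1 0 else mx2 0 1 1 0
  | Rho3 h => if odd h then mx2 0 (- 'i%C) 1 0 else mx2 0 (- 1) 1 0
  end.

End Irreps.

(* Main.v *)
(* A permutation model of a and b acts transitively on the 8n normal forms
   a ^+ i * b ^+ j (i < 2n, j < 4), so #|G| = 8n and these normal forms are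
   unique; hence matrices satisfying the relations extend to a representation of
   G. The listed representations are irreducible because the degree 2 ones send a
   to a diagonal matrix with distinct entries that b permutes, and they are
   separated by the traces of a, b and b ^+ 2. Since 8 * 1 ^ 2 + 2 * (n - 1) * 2 ^ 2
   = 8n = #|G|, there is no room for another irreducible representation. *)
Require Import Defs.
From mathcomp Require Import all_boot all_order all_algebra all_fingroup.
From mathcomp Require Import mxrepresentation complex reals.
From mathcomp Require Import ring zify.
From mathcomp Require Import pgroup exp trigo.
Set Implicit Arguments.
Unset Strict Implicit.
Unset Printing Implicit Defensive.

Import Order.TTheory GRing.Theory Num.Theory.

(** * A group of permutations of the [8n] normal forms *)

Section PermutationModel.

Variable n : nat.
Hypothesis n_gt0 : 0 < n.

Local Notation T := ('Z_(2 * n) * 'Z_4)%type.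

Local Open Scope ring_scope.

(* Left multiplication by a and b on the normal forms a ^+ i * b ^+ j, encoded
   as (i, j): the exponent j wraps around at 4 with carry b ^+ 4 = a ^+ n. *)
Definition model_a_fun (p : T) : T := (p.1 + 1, p.2).
Definition model_b_fun (p : T) : T :=
  ((if p.2 == 3%:R then n%:R else 0) - p.1, p.2 + 1).

Lemma model_a_inj : injective model_a_fun.
Proof.
by move=> [i j] [i' j'] /pair_equal_spec[/= /addIr -> ->].
Qed.

Lemma model_b_inj : injective model_b_fun.
Proof.
move=> [i j] [i' j'] /pair_equal_spec[/= + /addIr ej].
by rewrite ej => /addrI/oppr_inj ->.
Qed.

Definition model_a : {perm T} := perm model_a_inj.
Definition model_b : {perm T} := perm model_b_inj.

Lemma model_aX k p : (model_a ^+ k)%g p = (p.1 + k%:R, p.2).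
Proof.
elim: k => [|k IHk]; first by rewrite expg0 perm1 addr0; case: p.
by rewrite expgSr permM IHk permE /model_a_fun /= -addrA natr1.
Qed.

Lemma double_char : n%:R + n%:R = 0 :> 'Z_(2 * n).
Proof. by rewrite -natrD addnn -mul2n pchar_Zp // (leq_pmulr 2). Qed.

(** The four values of [j] are packed into one product so that [rewrite] can choose the rule that
    fits. *)
Lemma model_bE i :
  (model_b (i, 0) = (- i, 1)) * (model_b (i, 1) = (- i, 2%:R)) *
  (model_b (i, 2%:R) = (- i, 3%:R)) * (model_b (i, 3%:R) = (n%:R - i, 0)).
Proof.
have j4 : 3%:R + 1 = 0 :> 'Z_4 by apply/val_inj.
by do !split; rewrite permE /model_b_fun /= ?j4 ?natr1 ?add0r.
Qed.

Lemma Z4_cases (j : 'Z_4) : [\/ j = 0, j = 1, j = 2%:R | j = 3%:R].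
Proof.
by case: j => [[|[|[|[|//]]]] ltj];
  [apply: Or41 | apply: Or42 | apply: Or43 | apply: Or44]; apply/val_inj.
Qed.

(** Four steps negate [i] an even number of times and cross the carry exactly once; since [- n = n]
    modulo [2n], the negations that follow the carry do not affect it. *)
Lemma model_b4 p : (model_b ^+ 4)%g p = (p.1 + n%:R, p.2).
Proof.
have nN : - n%:R = n%:R :> 'Z_(2 * n).
  by apply/eqP; rewrite eq_sym -addr_eq0 double_char.
case: p => i j; rewrite !expgS expg0 mulg1 !permM.
by case: (Z4_cases j) => ->; rewrite !model_bE /= ?opprD ?opprK ?nN // addrC.
Qed.

Lemma model_relations :
  [/\ model_a ^+ (2 * n) = 1, model_b ^+ 8 = 1, model_a ^+ n = model_b ^+ 4
    & model_b^-1 * model_a * model_b = model_a^-1]%g.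
Proof.
(* Permutations compose from left to right, so left multiplication reverses products; in this form
   the relation is a palindrome and survives the reversal. *)
have aba : (model_a * model_b * model_a = model_b)%g.
  apply/permP=> p; rewrite !permM !permE /model_a_fun /model_b_fun /=.
  by rewrite opprD !addrA addrNK.
split.
- apply/permP=> p; rewrite model_aX perm1 pchar_Zp ?(leq_pmulr 2) // addr0.
  by case: p.
- apply/permP=> p; rewrite (expgM _ 4 2) expgS expg1 permM !model_b4 perm1 /=.
  by rewrite -addrA double_char addr0; case: p.
- by apply/permP=> p; rewrite model_aX model_b4.
- by apply: (mulIg model_a); rewrite mulVg -!mulgA (mulgA model_a) aba mulVg.
Qed.

(** The orbit of [0] is the whole of [T], and a group has at least as many elements as any of its
    orbits. *)
Lemma card_model : (2 * n * 4 <= #|<<[set model_a; model_b]>>%g|)%N.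
Proof.
have <-: #|{: T}| = (2 * n * 4)%N.
  by rewrite card_prod !card_ord Zp_cast // (leq_pmulr 2).
rewrite -cardsT; apply: leq_trans (leq_imset_card (fun s : {perm T} => s 0) _).
apply/subset_leq_card/subsetP=> -[i j] _; apply/imsetP.
(* [model_b] acts first: from [0], fewer than four steps never reach the carry. *)
exists (model_b ^+ j * model_a ^+ i)%g.
  by rewrite groupM // groupX // mem_gen // !inE eqxx ?orbT.
rewrite permM model_aX natr_Zp.
have -> : (model_b ^+ j)%g 0 = (0, j).
  by case: (Z4_cases j) => ->; rewrite ?expgS expg0 ?mulg1 ?permM ?perm1;
    rewrite ?model_bE ?oppr0.
by rewrite add0r.
Qed.

End PermutationModel.

(** * Order of the group and uniqueness of normal forms *)

Section NormalForm.

Variables (n : nat) (gT : finGroupType) (G : {group gT}) (a b : gT).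
Hypothesis n_gt0 : 0 < n.
Hypothesis G_T8n : T8n_presented n G a b.

Definition T8n_word (u : 'I_(2 * n) * 'I_4) : gT := (a ^+ u.1 * b ^+ u.2)%g.

(** Each block [b ^+ 4] is traded for [a ^+ n], and only then is the exponent of [a] reduced. *)
Definition T8n_exponents (i j : nat) : 'I_(2 * n) * 'I_4 :=
  let n2_gt0 := leq_trans n_gt0 (leq_pmull n (ltn0Sn 1)) in
  (Ordinal (ltn_pmod (i + n * (j %/ 4)) n2_gt0), Ordinal (ltn_pmod j (ltn0Sn 3))).

Lemma T8n_wordE i j : (a ^+ i * b ^+ j)%g = T8n_word (T8n_exponents i j).
Proof.
have [_ _ [a2n _ anb4 _]] := G_T8n.
rewrite /T8n_word /= expg_mod // expgD expgM anb4 -expgM -mulgA -expgD.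
by rewrite (mulnC 4) -divn_eq.
Qed.

(** As [b] normalizes [<[a]>], the group generated by both is the product of the two cyclic
    groups. *)
Lemma T8n_mem_word x : x \in G -> exists i j, x = (a ^+ i * b ^+ j)%g.
Proof.
have [_ defG [_ _ _ bab]] := G_T8n.
have -> : G :=: (<[a]> * <[b]>)%g.
  rewrite -norm_joinEr; first by rewrite joing_idl joing_idr.
  by rewrite cycle_subG; apply/normP; rewrite -cycleJ conjgE mulgA bab cycleV.
case/mulsgP=> y z /cycleP[i ->] /cycleP[j ->] ->.
by exists i, j.
Qed.

Lemma T8n_mem_a : a \in G.
Proof. by have [_ -> _] := G_T8n; rewrite mem_gen // !inE eqxx. Qed.

Lemma T8n_mem_b : b \in G.
Proof. by have [_ -> _] := G_T8n; rewrite mem_gen // !inE eqxx orbT. Qed.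

Lemma T8n_sub_words : G \subset T8n_word @: setT.
Proof.
by apply/subsetP=> x /T8n_mem_word[i [j ->]]; rewrite T8n_wordE imset_f.
Qed.

(** Normal forms bound the order from above; the permutation model satisfies the relations, so it is
    a quotient of [G] and bounds it from below. *)
Lemma card_T8n : #|G| = 2 * n * 4.
Proof.
have card_exps : #|[set: 'I_(2 * n) * 'I_4]| = 2 * n * 4.
  by rewrite cardsT card_prod !card_ord.
apply/eqP; rewrite eqn_leq -{1}card_exps.
rewrite (leq_trans (subset_leq_card T8n_sub_words)) ?leq_imset_card //=.
have [isoG _ _] := G_T8n; apply: leq_trans (card_model n_gt0) (leq_homg _).
rewrite isoG; apply/existsP; exists (model_a n, model_b n).
have [a2n b8 anb4 bab] := model_relations n_gt0.
by rewrite /= !xpair_eqE /= joing_idl joing_idr a2n b8 anb4 bab !eqxx.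
Qed.

Lemma T8n_word_inj : injective T8n_word.
Proof.
suffices /imset_injP inj : #|T8n_word @: setT| == #|[set: 'I_(2 * n) * 'I_4]|.
  by move=> u v; apply: inj; rewrite inE.
rewrite eqn_leq leq_imset_card cardsT card_prod !card_ord -card_T8n.
exact: subset_leq_card T8n_sub_words.
Qed.

(** * Extending matrices that satisfy the relations to a representation *)

Section Representation.

Variables (F : fieldType) (m : nat) (A B : 'M[F]_m).

Local Open Scope ring_scope.

Hypothesis A2n : A ^+ (2 * n) = 1.
Hypothesis AnB4 : A ^+ n = B ^+ 4.
Hypothesis ABA : A * B * A = B.

(** The default [1] is taken only outside [G]. *)
Definition T8n_rep_fun (x : gT) : 'M[F]_m :=
  if [pick u | T8n_word u == x] is Some u then A ^+ u.1 * B ^+ u.2 else 1.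

Lemma T8n_rep_funE i j : T8n_rep_fun (a ^+ i * b ^+ j)%g = A ^+ i * B ^+ j.
Proof.
rewrite T8n_wordE /T8n_rep_fun.
case: pickP => [u /eqP/T8n_word_inj -> | /(_ (T8n_exponents i j))]; last first.
  by rewrite eqxx.
rewrite /= expr_mod // exprD exprM AnB4 -exprM -mulrA -exprD.
by rewrite (mulnC 4) -divn_eq.
Qed.

(* The exponent 2 * n - 1 stands for -1, so that both sides of b a = a^-1 b are
   positive words. *)
Lemma T8n_swap i j :
  exists k, (b ^+ j * a ^+ i = a ^+ k * b ^+ j)%g /\
            B ^+ j * A ^+ i = A ^+ k * B ^+ j.
Proof.
have [_ _ [a2n _ _ bab]] := G_T8n.
have n2_gt0 : (0 < 2 * n)%N by rewrite muln_gt0.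
have ba : (b * a = a ^+ (2 * n).-1 * b)%g.
  apply: (mulgI a); rewrite [RHS]mulgA -expgS prednK // a2n mul1g.
  have ab : (a * b = b * a^-1)%g by rewrite -bab !mulgA mulgV mul1g.
  by rewrite mulgA ab mulgKV.
have BA : B * A = A ^+ (2 * n).-1 * B.
  by rewrite -{2}ABA !mulrA -exprSr prednK // A2n mul1r.
have bai k : (b * a ^+ k = a ^+ ((2 * n).-1 * k) * b)%g.
  elim: k => [|k IHk]; first by rewrite muln0 mulg1 mul1g.
  by rewrite mulnSr expgSr expgD mulgA IHk -!mulgA ba.
have BAi k : B * A ^+ k = A ^+ ((2 * n).-1 * k) * B.
  elim: k => [|k IHk]; first by rewrite muln0 mulr1 mul1r.
  by rewrite mulnSr exprSr exprD mulrA IHk -!mulrA BA.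
elim: j i => [|j IHj] i.
  by exists i; rewrite !expg0 !expr0 !mul1g !mulg1 !mul1r !mulr1.
(* The innermost [b] multiplies the exponent of [a] by [2n - 1], on the group side and on the matrix
   side alike, so one [k] serves both. *)
have [k [ba_k BA_k]] := IHj ((2 * n).-1 * i)%N.
exists k; rewrite !expgSr !exprSr -mulgA bai -mulrA BAi.
by rewrite [LHS]mulgA ba_k !mulgA [X in _ /\ X = _]mulrA BA_k !mulrA.
Qed.

(** A product of two words becomes a word again by swapping its middle factors, and [T8n_swap]
    performs the same swap on the matrices. *)
Lemma T8n_rep_repr : mx_repr G T8n_rep_fun.
Proof.
split=> [|x y /T8n_mem_word[i [j ->]] /T8n_mem_word[k [l ->]]].
  by have := T8n_rep_funE 0 0; rewrite !expg0 !expr0 mulg1 mulr1.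
have [k' [ba BA]] := T8n_swap k j.
rewrite !T8n_rep_funE mulgA -(mulgA (a ^+ i)%g) ba !mulgA -expgD -mulgA -expgD.
rewrite T8n_rep_funE -[RHS]/(A ^+ i * B ^+ j * (A ^+ k * B ^+ l)) mulrA.
by rewrite -(mulrA (A ^+ i)) BA !exprD !mulrA.
Qed.

Definition T8n_rep := MxRepresentation T8n_rep_repr.

Lemma T8n_rep_a : T8n_rep a = A.
Proof. by rewrite -[a]mulg1 -{1}[a]expg1 -(expg0 b) /= T8n_rep_funE mulr1. Qed.

Lemma T8n_rep_b : T8n_rep b = B.
Proof. by rewrite -[b]mul1g -(expg0 a) -{1}[b]expg1 /= T8n_rep_funE mul1r. Qed.

End Representation.

End NormalForm.

(** * Completeness of a family of irreducibles by the sum of squared degrees *)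

Lemma inj_sum_surj (I J : finType) (g : I -> J) (w : J -> nat) :
  injective g -> (forall j, 0 < w j) -> \sum_i w (g i) = \sum_j w j ->
  forall j, exists i, j = g i.
Proof.
move=> g_inj w_gt0 eq_w j; apply/codomP; apply: contraT => g'j.
have sum_codom : \sum_(k in codom g) w k = \sum_i w (g i).
  have uniq_g : uniq (codom g) by rewrite map_inj_uniq // enum_uniq.
  by rewrite -(big_uniq _ uniq_g) big_map big_enum.
(* The image already accounts for the whole sum, so a point outside it would have weight 0. *)
have := eq_w; rewrite [RHS](bigID [in codom g]) /= sum_codom.
move/eqP; rewrite -[X in X == _]addn0 eqn_add2l (bigD1 j) //= eq_sym addn_eq0.
by rewrite eqn0Ngt w_gt0.
Qed.

Section Completeness.

Variables (F : closedFieldType) (gT : finGroupType) (G : {group gT}).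
Variables (I : finType) (d : I -> nat).
Variable rho : forall i, mx_representation F G (d i).
Hypothesis F'G : ([pchar F]%R^'.-group G)%g.
Hypothesis rho_irr : forall i, mx_irreducible (rho i).
Hypothesis rho_inj : forall i j, mx_rsim (rho i) (rho j) -> i = j.
Hypothesis sum_d2 : \sum_i d i ^ 2 = #|G|.

Lemma irr_family_complete m (r : mx_representation F G m) :
  mx_irreducible r -> exists i, mx_rsim r (rho i).
Proof.
(* The components of the regular representation index all irreducibles, and their squared degrees
   add up to the order of [G]. *)
pose sG : irrType F G := DecSocleType (regular_repr F G).
pose comp i := irr_comp sG (rho i).
have rho_comp i : mx_rsim (rho i) (irr_repr (comp i)).
  exact: rsim_irr_comp_pchar.
have comp_inj : injective comp.
  move=> i j eq_ij; apply: rho_inj; apply: mx_rsim_trans (rho_comp i) _.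
  by rewrite eq_ij; apply/mx_rsim_sym/rho_comp.
move=> r_irr.
have [||i def_i] := inj_sum_surj (w := fun j => irr_degree j ^ 2) comp_inj _ _
  (irr_comp sG r).
- by move=> j; rewrite expn_gt0 irr_degree_gt0.
- rewrite sum_irr_degree_pchar //; last exact: group_closure_closed_field.
  by rewrite -sum_d2; apply: eq_bigr => i _; rewrite (mxrank_rsim (rho_comp i)).
exists i; apply: mx_rsim_trans (rsim_irr_comp_pchar sG F'G r_irr) _.
by rewrite def_i; apply/mx_rsim_sym/rho_comp.
Qed.

End Completeness.

(** * Powers of [omega] and [xi] through angles *)

Section RootsOfUnity.

Variable R : realType.

Local Open Scope ring_scope.
Local Open Scope complex_scope.

Definition cis (t : R) : complex R := cos t +i* sin t.

Lemma cexp_imag (t : R) : cexp (t%:C * 'i%C) = cis t.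
Proof. by rewrite /cexp /= !(mulr0, mulr1, mul0r) subrr addr0 expR0 !mul1r. Qed.

Lemma cisD s t : cis (s + t) = cis s * cis t.
Proof. by rewrite /cis cosD sinD; simpc; rewrite [sin s * _ + _]addrC. Qed.

Lemma cis0 : cis 0 = 1.
Proof. by rewrite /cis cos0 sin0. Qed.

Lemma cisX t k : cis t ^+ k = cis (t *+ k).
Proof.
by elim: k => [|k IHk]; rewrite ?expr0 ?mulr0n ?cis0 // exprS mulrS cisD IHk.
Qed.

Lemma cisV t : (cis t)^-1 = cis (- t).
Proof.
have tV : cis t * cis (- t) = 1 by rewrite -cisD subrr cis0.
by rewrite -[RHS]mul1r -(mulVf (_ : cis t != 0)) -?mulrA ?tV ?mulr1 //;
  apply: contra_eq_neq tV => ->; rewrite mul0r eq_sym oner_eq0.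
Qed.

Lemma omega2 : omega R ^+ 2 = 'i%C.
Proof.
rewrite /omega cexp_imag cisX /cis.
by rewrite (_ : _ *+ 2 = pi / 2) ?cos_pihalf ?sin_pihalf //; field.
Qed.

Variable n : nat.
Hypothesis n_gt0 : (0 < n)%N.

Lemma xiX k : xi R n ^+ k = cis (pi / n%:R *+ k).
Proof. by rewrite /xi cexp_imag cisX. Qed.

Lemma xi_neq0 k : xi R n ^+ k != 0.
Proof.
rewrite xiX /cis eq_complex /=; apply/negP => /andP[/eqP c0 /eqP s0].
have := cos2Dsin2 (pi / n%:R *+ k : R).
by rewrite c0 s0 expr0n addr0 => /esym/eqP; rewrite oner_eq0.
Qed.

Lemma xi_n : xi R n ^+ n = -1.
Proof.
rewrite xiX -mulr_natr divfK ?pnatr_eq0 -?lt0n // /cis cospi sinpi.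
by apply/eqP; rewrite eq_complex /= oppr0 !eqxx.
Qed.

Lemma angle_bounds k : (0 < k < n)%N -> 0 < (pi / n%:R *+ k : R) < pi.
Proof.
case/andP=> k_gt0 ltkn; rewrite -mulr_natr mulrAC.
rewrite ltr_pdivlMr ?ltr_pdivrMr ?ltr0n // mul0r.
by rewrite ltr_pM2l ?pi_gt0 // ltr_nat ltkn mulr_gt0 ?pi_gt0 ?ltr0n.
Qed.

(** The imaginary parts are opposite, and nonzero because the angle lies strictly between 0 and
    [pi]. *)
Lemma xi_neqV k : (0 < k < n)%N -> xi R n ^+ k != xi R n ^- k.
Proof.
move=> /angle_bounds/sin_gt0_pi s_gt0; rewrite xiX cisV /cis sinN eq_complex /=.
by rewrite negb_and -addr_eq0 -mulr2n mulrn_eq0 (gt_eqF s_gt0) orbT.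
Qed.

(** The sum is twice the cosine of the angle, and cosine is injective on the interval from 0 to
    [pi]. *)
Lemma xi_trace_inj k k' : (0 < k < n)%N -> (0 < k' < n)%N ->
  xi R n ^+ k + xi R n ^- k = xi R n ^+ k' + xi R n ^- k' -> k = k'.
Proof.
move=> /angle_bounds/andP[k0 kpi] /angle_bounds/andP[k'0 k'pi].
rewrite !xiX !cisV /cis !cosN => /(congr1 (@complex.Re _)) /= /eqP.
rewrite -!mulr2n eqrMn2r // => /eqP/cos_inj eq_angle.
have /eqP : pi / n%:R *+ k = pi / n%:R *+ k' :> R.
  by apply: eq_angle; rewrite in_itv /= !ltW.
have angle_neq0 : pi / n%:R != 0 :> R.
  by rewrite mulf_neq0 ?invr_eq0 ?pnatr_eq0 -?lt0n // gt_eqF // pi_gt0.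
rewrite -[_ *+ k]mulr_natr -[_ *+ k']mulr_natr.
by rewrite (inj_eq (mulfI angle_neq0)) eqr_nat => /eqP.
Qed.

End RootsOfUnity.

(** * Relations and irreducibility for matrices of degree 1 and 2 *)

Section TwoByTwo.

Variable R : realType.
Local Notation C := (complex R).

Local Open Scope ring_scope.

Lemma mx2M (x y z t x' y' z' t' : C) :
  mx2 x y z t * mx2 x' y' z' t' =
  mx2 (x * x' + y * z') (x * y' + y * t') (z * x' + t * z') (z * y' + t * t').
Proof.
apply/matrixP=> i j; rewrite !mxE !big_ord_recl big_ord0 !mxE addr0.
by case: i j => [[|[|//]] lti] [[|[|//]] ltj].
Qed.

Lemma mx2_scalar (x : C) : mx2 x 0 0 x = x%:M.
Proof.
apply/matrixP=> i j; rewrite !mxE.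
by case: i j => [[|[|//]] lti] [[|[|//]] ltj].
Qed.

Lemma mx2_diagX (x y : C) k : mx2 x 0 0 y ^+ k = mx2 (x ^+ k) 0 0 (y ^+ k).
Proof.
elim: k => [|k IHk]; first by rewrite !expr0 mx2_scalar.
by rewrite !exprS IHk mx2M !(mul0r, mulr0, addr0, add0r).
Qed.

Lemma mx2_trace (x y z t : C) : \tr (mx2 x y z t) = x + t.
Proof. by rewrite /mxtrace !big_ord_recl big_ord0 !mxE addr0. Qed.

Lemma mx2_antidiag_sqr (c : C) : mx2 0 c 1 0 ^+ 2 = c%:M.
Proof.
by rewrite expr2 mx2M !(mul0r, mulr0, addr0, add0r, mulr1, mul1r) mx2_scalar.
Qed.

(** [B ^+ 2] is the scalar [c], and [c ^+ 4 = 1] makes both diagonal entries of [A ^+ n] equal to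
    [c ^+ 2]. *)
Lemma mx2_relations n (x c : C) : x != 0 -> x ^+ n = c ^+ 2 -> c ^+ 4 = 1 ->
  let A := mx2 x 0 0 x^-1 in let B := mx2 0 c 1 0 in
  [/\ A ^+ (2 * n) = 1, A ^+ n = B ^+ 4 & A * B * A = B].
Proof.
move=> x_neq0 xn c4 A B.
have c2V : c ^- 2 = c ^+ 2.
  apply: (mulfI (_ : c ^+ 2 != 0)); first by rewrite -xn expf_neq0.
  by rewrite -exprD c4 mulfV // -xn expf_neq0.
have B4 : B ^+ 4 = (c ^+ 2)%:M.
  by rewrite (exprM _ 2 2) mx2_antidiag_sqr -rmorphXn.
have An : A ^+ n = (c ^+ 2)%:M by rewrite mx2_diagX exprVn xn c2V mx2_scalar.
have c22 : (c ^+ 2)%:M ^+ 2 = 1 :> 'M_2 by rewrite -rmorphXn -exprM /= c4.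
split; first by rewrite mulnC exprM An c22.
- by rewrite An B4.
- rewrite !mx2M !(mul0r, mulr0, addr0, add0r, mulr1, mul1r).
  by rewrite mulrAC mulfV // mulVf ?mul1r.
Qed.

(** Here the parity of [n] enters: it gives [s ^+ n = 1 = w ^+ 4] even for [s = -1]. *)
Lemma scalar1_relations n (s w : C) : ~~ odd n -> s ^+ 2 = 1 -> w ^+ 4 = 1 ->
  let A := s%:M : 'M_1 in let B := w%:M : 'M_1 in
  [/\ A ^+ (2 * n) = 1, A ^+ n = B ^+ 4 & A * B * A = B].
Proof.
move=> n_even s2 w4 A B; rewrite -!rmorphXn -!rmorphM /=.
have -> : s ^+ n = 1.
  by rewrite -(odd_double_half n) (negbTE n_even) -mul2n exprM s2 expr1n.
by rewrite exprM s2 expr1n w4 mulrAC -expr2 s2 mul1r.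
Qed.

Lemma mx2_irreducible (gT : finGroupType) (G : {group gT}) (a b : gT)
    (r : mx_representation C G 2) (x y c : C) :
  a \in G -> b \in G -> r a = mx2 x 0 0 y -> r b = mx2 0 c 1 0 ->
  x != y -> c != 0 -> mx_irreducible r.
Proof.
move=> Ga Gb ra rb neq_xy c_neq0; apply/mx_irrP.
split=> // U /mxmoduleP Umod U_neq0.
have Ua := Umod a Ga; have Ub := Umod b Gb.
rewrite {}ra in Ua; rewrite {}rb in Ub.
have stab (M : 'M_2) (u : 'rV_2) :
    stablemx U M -> (u <= U)%MS -> (u *m M <= U)%MS.
  by move=> UM uU; apply: submx_trans UM; apply: submxMr.
pose e0 : 'rV[C]_2 := delta_mx 0 0; pose e1 : 'rV[C]_2 := delta_mx 0 1.
have rowE (u : 'rV[C]_2) : u = u 0 0 *: e0 + u 0 1 *: e1.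
  rewrite [LHS]row_sum_delta !big_ord_recl big_ord0 addr0.
  by congr (_ + u _ _ *: delta_mx _ _); apply/val_inj.
have mulE (u : 'rV[C]_2) (p q s t : C) :
    u *m mx2 p q s t =
    (u 0 0 * p + u 0 1 * s) *: e0 + (u 0 0 * q + u 0 1 * t) *: e1.
  rewrite [LHS]rowE !mxE !big_ord_recl !big_ord0 !mxE !addr0 /=.
  by congr ((_ + u _ _ * _) *: _ + (_ + u _ _ * _) *: _); apply/val_inj.
have basis : (e0 <= U)%MS -> (e1 <= U)%MS -> row_full U.
  move=> e0U e1U; rewrite -sub1mx; apply/row_subP=> i.
  by rewrite [row i _]rowE addmx_sub // scalemx_sub.
(* On row vectors, [b] sends [e0] to [c *: e1] and [e1] to [e0], so either one generates
   everything. *)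
have e0_full : (e0 <= U)%MS -> row_full U.
  move=> e0U; apply: basis => //.
  have := stab _ _ Ub e0U.
  rewrite mulE !mxE /= !(mulr0, mul0r, mul1r, add0r, addr0).
  by rewrite scale0r add0r (eqmx_scale _ c_neq0).
have e1_full : (e1 <= U)%MS -> row_full U.
  move=> e1U; apply: e0_full.
  have := stab _ _ Ub e1U.
  rewrite mulE !mxE /= !(mulr0, mul0r, mul1r, add0r, addr0).
  by rewrite scale0r addr0 scale1r.
have [i Ui_neq0] : exists i, row i U != 0.
  apply/existsP; rewrite -negb_forall; apply: contra U_neq0 => /forallP U0.
  by apply/eqP/row_matrixP=> i; rewrite row0; apply/eqP.
set u := row i U in Ui_neq0; have uU : (u <= U)%MS by apply: row_sub.
have [u0 | u0] := eqVneq (u 0 0) 0.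
  apply: e1_full; move: Ui_neq0 uU; rewrite [u]rowE u0 scale0r add0r.
  by rewrite scaler_eq0 negb_or => /andP[u1 _]; rewrite (eqmx_scale _ u1).
apply: e0_full.
(* Subtracting [y *: u] kills the [e1] coordinate and multiplies the other one by [x - y], which is
   nonzero. *)
have : (u *m mx2 x 0 0 y - y *: u <= U)%MS.
  by rewrite addmx_sub ?stab // eqmx_opp scalemx_sub.
rewrite mulE [X in _ - _ *: X]rowE !(mulr0, addr0, add0r) scalerDr !scalerA.
rewrite !(mulrC _ y) opprD addrACA subrr addr0 mulrC -scalerBl -mulrBl mulrC.
by rewrite eqmx_scale // mulf_neq0 // subr_eq0.
Qed.

End TwoByTwo.

(** * The listed matrices satisfy the relations *)

Section Labels.

Variable R : realType.
Local Notation C := (complex R).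

Local Open Scope ring_scope.
Local Open Scope complex_scope.

(** A square root of [(-1) ^+ k], the [n]-th power of [xi ^+ k]; [Rho2] and [Rho3] use the two
    opposite roots as the corner of [b]. *)
Definition twist (k : nat) : C := if odd k then 'i%C else 1.

Lemma twist_sqr k : twist k ^+ 2 = (-1) ^+ k.
Proof. by rewrite /twist -signr_odd; case: odd; rewrite ?sqr_i ?expr1n. Qed.

Lemma twist_neq0 k : twist k != 0.
Proof. by have := signr_eq0 C k; rewrite -twist_sqr expf_eq0 => /= ->. Qed.

Lemma twist_neqN k : twist k != - twist k.
Proof. by rewrite -addr_eq0 -mulr2n mulrn_eq0 twist_neq0. Qed.

Lemma imagX_inj m m' :
  (m < 4)%N -> (m' < 4)%N -> 'i%C ^+ m = 'i%C ^+ m' :> C -> m = m'.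
Proof.
wlog le_mm' : m m' / (m <= m')%N.
  by move=> W lt_m lt_m'; case/orP: (leq_total m m') => le eq_i;
    [|symmetry]; apply: W.
move=> _ lt_m'; rewrite -(subnK le_mm').
have : (m' - m < 4)%N by apply: leq_ltn_trans (leq_subr _ _) lt_m'.
have im_neq0 : 'i%C ^+ m != 0 :> C.
  by rewrite expf_neq0 // eq_complex /= oner_eq0 andbF.
(* Cancelling ['i ^+ m] leaves a power with exponent below 4 that equals 1. *)
rewrite exprD -[X in X = _]mul1r => + /(mulIf im_neq0)/eqP.
case: (m' - m)%N => [|[|[|[|//]]]] _; rewrite ?add0n //.
- by rewrite expr1 eq_complex /= oner_eq0.
- by rewrite sqr_i -addr_eq0 -mulr2n pnatr_eq0.
- by rewrite exprS sqr_i mulrN1 eq_complex /= oppr0 oner_eq0.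
Qed.

Lemma Rho1_a n j : T8n_mx_a R n (Rho1 j) = ((-1) ^+ j)%:M.
Proof. by rewrite /= -signr_odd; case: odd. Qed.

(** For either parity the exponent of [omega] is twice [j./2], and [omega ^+ 2] is ['i]. *)
Lemma Rho1_b j : T8n_mx_b R (Rho1 j) = ('i%C ^+ j./2)%:M.
Proof.
rewrite /= -omega2 -exprM mul2n -{2 3}(odd_double_half j).
by case: odd; rewrite // add1n subn1.
Qed.

Lemma Rho2_b k : T8n_mx_b R (Rho2 k) = mx2 0 (twist k) 1 0.
Proof. by rewrite /= /twist; case: odd. Qed.

Lemma Rho3_b k : T8n_mx_b R (Rho3 k) = mx2 0 (- twist k) 1 0.
Proof. by rewrite /= /twist; case: odd. Qed.

Lemma twist_relations n k (c : C) : (0 < n)%N -> c ^+ 2 = (-1) ^+ k ->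
  let A := mx2 (xi R n ^+ k) 0 0 (xi R n ^- k) in let B := mx2 0 c 1 0 in
  [/\ A ^+ (2 * n) = 1, A ^+ n = B ^+ 4 & A * B * A = B].
Proof.
move=> n_gt0 c2; apply: mx2_relations; first exact: xi_neq0.
- by rewrite -exprM mulnC exprM xi_n.
- by rewrite (exprM _ 2 2) c2 sqrr_sign.
Qed.

Lemma label_relations n l : (0 < n)%N -> ~~ odd n ->
  let A := T8n_mx_a R n l in let B := T8n_mx_b R l in
  [/\ A ^+ (2 * n) = 1, A ^+ n = B ^+ 4 & A * B * A = B].
Proof.
move=> n_gt0 n_even; case: l => [j|k|h]; cbv zeta.
- rewrite Rho1_a Rho1_b; apply: scalar1_relations => //.
    by rewrite sqrr_sign.
  by rewrite exprAC (exprM _ 2 2) sqr_i sqrrN !expr1n.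
- by rewrite Rho2_b; apply: twist_relations => //; rewrite twist_sqr.
- by rewrite Rho3_b; apply: twist_relations => //; rewrite sqrrN twist_sqr.
Qed.

End Labels.

(** * The listed representations: irreducible, pairwise inequivalent, complete *)

Section IrreducibleRepresentations.

Variables (R : realType) (n : nat).
Hypotheses (n_gt0 : 0 < n) (n_even : ~~ odd n).
Variables (gT : finGroupType) (G : {group gT}) (a b : gT).
Hypothesis G_T8n : T8n_presented n G a b.

Local Notation C := (complex R).

(** A sigma type, so that the representation can be extracted as a function of [l]. *)
Lemma T8n_rep_exists l :
  {r : mx_representation C G (T8n_degree l) |
    r a = T8n_mx_a R n l /\ r b = T8n_mx_b R l}.
Proof.
have [A2n AnB4 ABA] := label_relations R l n_gt0 n_even.
exists (T8n_rep n_gt0 G_T8n A2n AnB4 ABA).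
by rewrite T8n_rep_a T8n_rep_b.
Qed.

Definition T8n_irr l := sval (T8n_rep_exists l).

Lemma T8n_irr_a l : T8n_irr l a = T8n_mx_a R n l.
Proof. exact: (svalP (T8n_rep_exists l)).1. Qed.

Lemma T8n_irr_b l : T8n_irr l b = T8n_mx_b R l.
Proof. exact: (svalP (T8n_rep_exists l)).2. Qed.

Lemma T8n_irr_irreducible l : T8n_label_valid n l -> mx_irreducible (T8n_irr l).
Proof.
have Ga := T8n_mem_a G_T8n; have Gb := T8n_mem_b G_T8n.
have:= T8n_irr_b l; have:= T8n_irr_a l; case: l => [j|k|h].
- by move=> _ _ _; apply: mx_abs_irrW; apply: linear_mx_abs_irr.
- rewrite Rho2_b => ra rb /(xi_neqV R n_gt0) xi_neq.
  exact: mx2_irreducible Ga Gb ra rb xi_neq (twist_neq0 R k).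
- rewrite Rho3_b => ra rb /(xi_neqV R n_gt0) xi_neq.
  by apply: mx2_irreducible Ga Gb ra rb xi_neq _; rewrite oppr_eq0 twist_neq0.
Qed.

Local Open Scope ring_scope.

(* b acts with trace 0 in degree 2, whereas b ^+ 2 is the scalar that tells rho_2
   from rho_3. *)
Lemma T8n_irr_sim l l' : mx_rsim (T8n_irr l) (T8n_irr l') ->
  [/\ T8n_degree l = T8n_degree l', \tr (T8n_mx_a R n l) = \tr (T8n_mx_a R n l'),
      \tr (T8n_mx_b R l) = \tr (T8n_mx_b R l')
    & \tr (T8n_mx_b R l ^+ 2) = \tr (T8n_mx_b R l' ^+ 2)].
Proof.
have Ga := T8n_mem_a G_T8n; have Gb := T8n_mem_b G_T8n.
have b2 k : T8n_irr k (b * b)%g = T8n_irr k b ^+ 2.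
  by rewrite repr_mxM // expr2.
move=> sim; have tr := mxtrace_rsim sim.
by rewrite -!T8n_irr_a -!T8n_irr_b -!b2 !tr ?groupM ?(mxrank_rsim sim).
Qed.

Lemma T8n_irr_inj l l' : T8n_label_valid n l -> T8n_label_valid n l' ->
  mx_rsim (T8n_irr l) (T8n_irr l') -> l = l'.
Proof.
have eq_scalar (c c' : C) : \tr (c%:M : 'M_2) = \tr (c'%:M : 'M_2) -> c = c'.
  by rewrite !mxtrace_scalar => /eqP; rewrite eqrMn2r // => /eqP.
have eq_index k h (c c' : C) : (0 < k < n)%N -> (0 < h < n)%N ->
    \tr (T8n_mx_a R n (Rho2 k)) = \tr (T8n_mx_a R n (Rho2 h)) ->
    \tr (mx2 0 c 1 0 ^+ 2) = \tr (mx2 0 c' 1 0 ^+ 2) -> k = h /\ c = c'.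
  move=> k_n h_n; rewrite !mx2_antidiag_sqr !mx2_trace => eq_a /eq_scalar eq_b.
  by split=> //; apply: (@xi_trace_inj R n).
move=> + + /T8n_irr_sim[].
(* Pairs of labels of different degrees are discarded by [//]. *)
case: l l' => [j|k|k] [j'|h|h] // lt_l lt_l' _.
- rewrite !Rho1_a !Rho1_b !mxtrace_scalar => eq_a /imagX_inj eq_half _.
  (* The trace of [a] gives the parity of [j], that of [b] gives [j./2]. *)
  have eq_odd : odd j = odd j'.
    by apply: (@signr_inj C); rewrite !signr_odd.
  rewrite -[j]odd_double_half -[j']odd_double_half eq_odd eq_half //;
    by rewrite ltn_half_double.
- rewrite !Rho2_b => eq_a _ eq_b.
  by have [-> _] := eq_index _ _ _ _ lt_l lt_l' eq_a eq_b.
- rewrite Rho2_b Rho3_b => eq_a _ eq_b.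
  have [eq_k /eqP] := eq_index _ _ _ _ lt_l lt_l' eq_a eq_b.
  by rewrite eq_k (negbTE (twist_neqN R h)).
- rewrite Rho2_b Rho3_b => eq_a _ eq_b.
  have [eq_k /eqP] := eq_index _ _ _ _ lt_l lt_l' eq_a eq_b.
  by rewrite eq_k eq_sym (negbTE (twist_neqN R h)).
- rewrite !Rho3_b => eq_a _ eq_b.
  by have [-> _] := eq_index _ _ _ _ lt_l lt_l' eq_a eq_b.
Qed.

Lemma T8n_irr_complete m (r : mx_representation C G m) :
  mx_irreducible r -> exists2 l, T8n_label_valid n l & mx_rsim r (T8n_irr l).
Proof.
(* The valid labels as a finite type; ordinals start at 0, hence the successors in [lab]. *)
pose I := ('I_8 + ('I_n.-1 + 'I_n.-1))%type.
pose lab (i : I) := match i with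
  | inl j => Rho1 j | inr (inl k) => Rho2 k.+1 | inr (inr h) => Rho3 h.+1 end.
have lab_valid i : T8n_label_valid n (lab i).
  by case: i => [j|[k|h]] //=; rewrite -ltn_predRL.
have lab_inj : injective lab.
  by move=> [j|[k|h]] [j'|[k'|h']] //= [/ord_inj ->].
move=> r_irr.
have [||||i r_sim] :=
  @irr_family_complete C gT G I _ (fun i => T8n_irr (lab i)) _ _ _ _ m r r_irr.
- by apply/pgroupP=> p _ _; rewrite inE /= pchar_num.
- by move=> i; apply: T8n_irr_irreducible.
- by move=> i j /T8n_irr_inj/lab_inj; apply.
- rewrite (card_T8n n_gt0 G_T8n) !big_sumType /= !sum_nat_const !card_ord.
  by case: (n) n_gt0 => // k _ /=; rewrite !mulnS; lia.
by exists (lab i).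
Qed.

End IrreducibleRepresentations.

Theorem lemma2p8 (R : realType) (n : nat) (n_gt0 : (0 < n)%N) (n_even : ~~ odd n)
    (gT : finGroupType) (G : {group gT}) (a b : gT)
    (G_T8n : T8n_presented n G a b) :
  exists rho : forall l : T8n_label,
      mx_representation (complex R) G (T8n_degree l),
    [/\ forall l, T8n_label_valid n l ->
          rho l a = T8n_mx_a R n l /\ rho l b = T8n_mx_b R l,
        forall l, T8n_label_valid n l -> mx_irreducible (rho l),
        forall (m : nat) (r : mx_representation (complex R) G m),
          mx_irreducible r ->
          exists2 l, T8n_label_valid n l & mx_rsim r (rho l)
      & forall l l', T8n_label_valid n l -> T8n_label_valid n l' ->
          mx_rsim (rho l) (rho l') -> l = l'].
Proof.
exists (T8n_irr R n_gt0 n_even G_T8n); split.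
- by move=> l _; rewrite T8n_irr_a T8n_irr_b.
- exact: T8n_irr_irreducible.
- exact: T8n_irr_complete.
- exact: T8n_irr_inj.
Qed.
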